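(* Let $\boldsymbol{A}\in\mathbb{R}^{n\times n}$ and let $\boldsymbol{G}\in\mathbb{R}^{n\times n}$ be an $\epsilon$-accurate approximate generalized inverse of $\boldsymbol{A}$. Then, in exact arithmetic, GMRES with right preconditioning operator $\boldsymbol{G}$ converges to a least-squares solution of $\boldsymbol{A}\boldsymbol{x}\approx\boldsymbol{b}$ for all $\boldsymbol{b}\in\mathcal{R}(\boldsymbol{A})$ and any initial guess $\boldsymbol{x}_{0}\in\mathbb{R}^{n}$.
   Context: $\mathcal{R}(\cdot)$ denotes the range. A generalized inverse of $\boldsymbol{A}$ is a matrix $\boldsymbol{A}^{g}$ with $\boldsymbol{A}\boldsymbol{A}^{g}\boldsymbol{A}=\boldsymbol{A}$. With $r=\mathrm{rank}(\boldsymbol{A})$, $\boldsymbol{G}\in\mathbb{R}^{n\times n}$ is an $\epsilon$-accurate approximate generalized inverse (AGI) of $\boldsymbol{A}$ if there exists a nonsingular $\boldsymbol{X}\in\mathbb{R}^{n\times n}$ satisfying $\boldsymbol{A}\boldsymbol{A}^{g}=\boldsymbol{X}\begin{bmatrix}\boldsymbol{I}_{r} & \boldsymbol 0\\ \boldsymbol 0 & \boldsymbol{0}\end{bmatrix}\boldsymbol{X}^{-1}$ for some generalized inverse $\boldsymbol{A}^{g}$ of $\boldsymbol{A}$, such that $$\left\Vert \boldsymbol{X}^{-1}\boldsymbol{A}\boldsymbol{G}\boldsymbol{X}-\begin{bmatrix}\boldsymbol{I}_{r} & \boldsymbol 0\\ \boldsymbol 0 & \boldsymbol{0}\end{bmatrix}\right\Vert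 _{2}=\epsilon<1.$$ A least-squares (LS) solution of $\boldsymbol{A}\boldsymbol{x}\approx\boldsymbol{b}$ is a minimizer of $\Vert\boldsymbol{b}-\boldsymbol{A}\boldsymbol{x}\Vert_{2}$. Let $\mathcal{K}_{k}(\boldsymbol{B},\boldsymbol{v})=\mathrm{span}\{\boldsymbol{v},\boldsymbol{B}\boldsymbol{v},\dots,\boldsymbol{B}^{k-1}\boldsymbol{v}\}$, $\mathcal{K}_0=\{\boldsymbol 0\}$. GMRES with right preconditioning operator $\boldsymbol{G}$ and initial guess $\boldsymbol{x}_0$ sets $\boldsymbol{r}_0=\boldsymbol{b}-\boldsymbol{A}\boldsymbol{x}_0$ and at step $k$ produces $\boldsymbol{x}_k=\boldsymbol{x}_0+\boldsymbol{G}\boldsymbol{y}_k$, where $\boldsymbol{y}_k$ minimizes $\Vert\boldsymbol{r}_0-\boldsymbol{A}\boldsymbol{G}\boldsymbol{y}\Vert_2$ over $\boldsymbol{y}\in\mathcal{K}_k(\boldsymbol{A}\boldsymbol{G},\boldsymbol{r}_0)$. GMRES breaks down at step $k$ when $\boldsymbol{r}_0,\boldsymbol{A}\boldsymbol{G}\boldsymbol{r}_0,\dots,(\boldsymbol{A}\boldsymbol{G})^{k-1}\boldsymbol{r}_0$ are linearly dependent. Converging to an LS solution means that, before any breakdown, some iterate $\boldsymbol{x}_k$ ($k\ge 0$) is an LS solution. *)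

(* Defs.v *)
From HB Require Import structures.
From mathcomp Require Import all_boot all_order all_algebra.
From mathcomp Require Import boolp classical_sets reals.

Set Implicit Arguments.
Unset Strict Implicit.
Unset Printing Implicit Defensive.

Import Order.TTheory GRing.Theory Num.Theory.

Local Open Scope classical_set_scope.
Local Open Scope ring_scope.

(* The library norm on matrices is the max norm, hence the explicit
   Euclidean and spectral norms. *)
Definition norm2 (R : realType) (n : nat) (v : 'cV[R]_n) : R :=
  Num.sqrt (\sum_(i < n) v i 0 ^+ 2).

(* The unit ball (rather than the unit sphere) keeps the set nonempty when
   n = 0; it is always bounded, so sup is the actual supremum. *)
Definition spectral_norm (R : realType) (m n : nat) (M : 'M[R]_(m, n)) : R :=
  sup [set norm2 (M *m v) | v in [set v : 'cV[R]_n | norm2 v <= 1]].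

Definition is_ginv (R : realType) (m n : nat)
    (A : 'M[R]_(m, n)) (Ag : 'M[R]_(n, m)) : Prop :=
  A *m Ag *m A = A.

(* pid_mx r is the block matrix [I_r, 0; 0, 0]. *)
Definition is_AGI (R : realType) (n : nat) (eps : R) (A G : 'M[R]_n) : Prop :=
  exists X Ag : 'M[R]_n,
    [/\ X \in unitmx,
        is_ginv A Ag,
        A *m Ag = X *m pid_mx (\rank A) *m invmx X,
        spectral_norm (invmx X *m A *m G *m X - pid_mx (\rank A)) = eps
      & eps < 1].

Definition is_LS_solution (R : realType) (m n : nat)
    (A : 'M[R]_(m, n)) (b : 'cV[R]_m) (x : 'cV[R]_n) : Prop :=
  forall z : 'cV[R]_n, norm2 (b - A *m x) <= norm2 (b - A *m z).

Definition krylov_seq (R : realType) (n : nat)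
    (k : nat) (B : 'M[R]_n) (v : 'cV[R]_n) : seq 'cV[R]_n :=
  [seq B ^+ i *m v | i <- iota 0 k].

Definition krylov (R : realType) (n : nat)
    (k : nat) (B : 'M[R]_n) (v : 'cV[R]_n) : {vspace 'cV[R]_n} :=
  <<krylov_seq k B v>>%VS.

(* The minimizing y need not be unique, so "x is a k-th iterate" is a
   relation. *)
Definition gmres_iterate (R : realType) (n : nat) (A G : 'M[R]_n)
    (b x0 : 'cV[R]_n) (k : nat) (x : 'cV[R]_n) : Prop :=
  let r0 := b - A *m x0 in
  exists y : 'cV[R]_n,
    [/\ y \in krylov k (A *m G) r0,
        forall z : 'cV[R]_n, z \in krylov k (A *m G) r0 ->
          norm2 (r0 - A *m G *m y) <= norm2 (r0 - A *m G *m z)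
      & x = x0 + G *m y].

Definition gmres_breakdown (R : realType) (n : nat) (A G : 'M[R]_n)
    (b x0 : 'cV[R]_n) (k : nat) : Prop :=
  ~~ free (krylov_seq k (A *m G) (b - A *m x0)).

(* Whichever minimizers are selected along the run, the iterate produced at
   step k is a least-squares solution; the existence clause excludes a vacuous
   reading of the universal one. *)
Definition gmres_converges (R : realType) (n : nat) (A G : 'M[R]_n)
    (b x0 : 'cV[R]_n) : Prop :=
  exists k : nat,
    [/\ forall j : nat, (j <= k)%N -> ~ gmres_breakdown A G b x0 j,
        exists x : 'cV[R]_n, gmres_iterate A G b x0 k x
      & forall x : 'cV[R]_n,
          gmres_iterate A G b x0 k x -> is_LS_solution A b x].

(* Main.v *)
Require Import Defs.
From mathcomp Require Import all_boot all_order all_algebra.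
From mathcomp Require Import boolp classical_sets reals.

(** Write [B = A G] and [r0 = b - A x0].  Because [b] lies in the range of [A],
    so does [r0], and hence so does every Krylov space [K_k(B, r0)].

    The accuracy hypothesis makes [B] injective on that range
    ([AGI_injective_on_range]).  In the coordinates given by [X], vectors of
    the range of [A] are those fixed by the projector [P = diag(I_r, 0)]; if
    [B] killed such a vector [w], then [X^-1 B X - P] would send [w] to [- w],
    which an operator of spectral norm less than 1 can only do to [w = 0].

    Take the last [k] for which the Krylov sequence of length [k] is free.
    Then [B^k r0] is a combination of the earlier terms, so [K_k] is stable
    under [B]; being finite dimensional and meeting the kernel of [B]
    trivially, it is mapped by [B] onto itself.  Since [r0] belongs to [K_k],
    the equation [B y = r0] has a solution in [K_k]: the least residual over
    [K_k] is 0, and every minimizer gives an exact solution of [A x = b],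
    before any breakdown. *)

Set Implicit Arguments.
Unset Strict Implicit.
Unset Printing Implicit Defensive.

Import Order.TTheory GRing.Theory Num.Theory.

Local Open Scope classical_set_scope.
Local Open Scope ring_scope.

Section Norm2.
Variable R : realType.

Lemma norm2_ge0 n (v : 'cV[R]_n) : 0 <= norm2 v.
Proof. exact: sqrtr_ge0. Qed.

Lemma sqr_norm2 n (v : 'cV[R]_n) : norm2 v ^+ 2 = \sum_(i < n) v i 0 ^+ 2.
Proof. by rewrite sqr_sqrtr // sumr_ge0 // => i _; rewrite sqr_ge0. Qed.

Lemma norm20 n : norm2 (0 : 'cV[R]_n) = 0.
Proof.
by rewrite /norm2 big1 ?sqrtr0 // => i _; rewrite mxE expr0n.
Qed.

Lemma norm2_eq0 n (v : 'cV[R]_n) : norm2 v = 0 -> v = 0.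
Proof.
move=> v0; have /eqP := sqr_norm2 v; rewrite v0 expr0n eq_sym.
rewrite psumr_eq0 => [/allP vP|i _]; last exact: sqr_ge0.
apply/colP => i; rewrite mxE; apply/eqP.
by have := vP i (mem_index_enum i); rewrite sqrf_eq0.
Qed.

Lemma norm2Z n (c : R) (v : 'cV[R]_n) : norm2 (c *: v) = `|c| * norm2 v.
Proof.
rewrite /norm2 -sqrtr_sqr -sqrtrM ?sqr_ge0 // mulr_sumr; congr Num.sqrt.
by apply: eq_bigr => i _; rewrite mxE exprMn.
Qed.

Lemma norm2N n (v : 'cV[R]_n) : norm2 (- v) = norm2 v.
Proof. by rewrite -scaleN1r norm2Z normrN1 mul1r. Qed.

Lemma ler_entry_norm2 n (v : 'cV[R]_n) i : `|v i 0| <= norm2 v.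
Proof.
rewrite -sqrtr_sqr ler_sqrt; last by rewrite sumr_ge0 // => j _; rewrite sqr_ge0.
by rewrite (bigD1 i) //= lerDl sumr_ge0 // => j _; rewrite sqr_ge0.
Qed.

(** Boundedness of the unit-ball image is what makes the [sup] in
    [spectral_norm] an upper bound; the crude row-sum bound suffices. *)
Lemma le_spectral_norm m n (M : 'M[R]_(m, n)) (v : 'cV[R]_n) :
  norm2 v <= 1 -> norm2 (M *m v) <= spectral_norm M.
Proof.
move=> v1; apply: ub_le_sup; last by exists v.
exists (Num.sqrt (\sum_(i < m) (\sum_(j < n) `|M i j|) ^+ 2)) => _ [u /= u1 <-].
apply: ler_wsqrtr; apply: ler_sum => i _; rewrite mxE -[leLHS]real_normK ?num_real //.
rewrite lerXn2r ?nnegrE ?normr_ge0 ?sumr_ge0 //.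
apply: le_trans (ler_norm_sum _ _ _) _; apply: ler_sum => j _.
by rewrite normrM ler_piMr // (le_trans (ler_entry_norm2 u j)).
Qed.

(** Rescaled to unit length, a nonzero vector with [M w = - w] would witness
    a spectral norm of at least 1. *)
Lemma spectral_norm_lt1_eigenN1 n (M : 'M[R]_n) (w : 'cV[R]_n) :
  spectral_norm M < 1 -> M *m w = - w -> w = 0.
Proof.
move=> M1 Mw; apply/norm2_eq0/eqP/contraT => w0.
have u1 : norm2 ((norm2 w)^-1 *: w) = 1.
  by rewrite norm2Z ger0_norm ?invr_ge0 ?norm2_ge0 // mulVf.
have := @le_spectral_norm n n M ((norm2 w)^-1 *: w).
by rewrite -scalemxAr Mw scalerN norm2N u1 lexx leNgt M1 => /(_ isT).
Qed.

End Norm2.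

Lemma AGI_injective_on_range (R : realType) n (eps : R) (A G : 'M[R]_n)
    (x : 'cV[R]_n) :
  is_AGI eps A G -> A *m G *m (A *m x) = 0 -> A *m x = 0.
Proof.
case=> X [Ag [Xu gA AAg nE e1]] Bv0; rewrite -nE in e1.
set v := A *m x in Bv0 *; set w := invmx X *m v.
have vX : X *m w = v by rewrite mulKVmx.
have Pw : pid_mx (\rank A) *m w = w.
  (* [A Ag] is a projector onto the range of [A], so it fixes [v]. *)
  have /(congr1 (mulmx (invmx X))) : A *m Ag *m v = v by rewrite mulmxA gA.
  by rewrite AAg -!mulmxA mulKmx.
suff w0 : w = 0 by rewrite -vX w0 mulmx0.
apply: spectral_norm_lt1_eigenN1 e1 _.
by rewrite mulmxBl Pw -!mulmxA vX (mulmxA A) Bv0 mulmx0 sub0r.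
Qed.

Section Krylov.
Variables (R : realType) (n : nat) (B : 'M[R]_n) (v : 'cV[R]_n).

Lemma size_krylov_seq k : size (krylov_seq k B v) = k.
Proof. by rewrite size_map size_iota. Qed.

Lemma krylov_seqS k :
  krylov_seq k.+1 B v = rcons (krylov_seq k B v) (B ^+ k *m v).
Proof. by rewrite /krylov_seq -(addn1 k) iotaD map_cat cats1. Qed.

Lemma mem_krylov k i : (i < k)%N -> B ^+ i *m v \in krylov k B v.
Proof.
move=> ik; apply/memv_span/mapP; exists i => //.
by rewrite mem_iota.
Qed.

(** Finite dimension forces dependence; the last length before it occurs is
    the one at which the newest power falls into the space already spanned. *)
Lemma krylov_saturation :
  exists k, (forall j, (j <= k)%N -> free (krylov_seq j B v)) /\
            B ^+ k *m v \in krylov k B v.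
Proof.
have dep : exists m, ~~ free (krylov_seq m B v).
  exists (\dim {: 'cV[R]_n}).+1; apply/negP => /eqP.
  rewrite size_krylov_seq => dimK.
  by have := dimvS (subvf (krylov (\dim {: 'cV[R]_n}).+1 B v)); rewrite dimK ltnn.
case: (ex_minnP dep) => -[|k] depk mink; first by rewrite nil_free in depk.
have freeK j : (j <= k)%N -> free (krylov_seq j B v).
  by move=> jk; apply: contraT => /mink; rewrite ltnNge jk.
exists k; split=> //; move: depk.
rewrite krylov_seqS (perm_free (permEl (perm_rcons _ _))) free_cons.
by rewrite freeK // andbT negbK.
Qed.

(** For [k > 0] the vector [v] is the first generator; the hypothesis only
    matters at [k = 0], where it forces [v = 0]. *)
Lemma krylov_start k : B ^+ k *m v \in krylov k B v -> v \in krylov k B v.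
Proof.
have v0 : B ^+ 0 *m v = v by rewrite expr0 mul1mx.
by case: k => [|k]; rewrite -{3}v0 // => _; apply: mem_krylov.
Qed.

(** A saturated Krylov space is stable under [B], and an injective
    endomorphism of a finite-dimensional space is onto. *)
Lemma krylov_solvable k :
    B ^+ k *m v \in krylov k B v ->
    (forall u, u \in krylov k B v -> B *m u = 0 -> u = 0) ->
  exists2 y, y \in krylov k B v & B *m y = v.
Proof.
move=> Kk injB; pose f : 'End('cV[R]_n) := linfun (mulmx B).
have fE u : f u = B *m u by rewrite lfunE.
have fK : (f @: krylov k B v <= krylov k B v)%VS.
  rewrite limg_span; apply/span_subvP => _ /mapP[_ /mapP[i ik ->] ->].
  rewrite fE mulmxA -[B *m B ^+ i]exprS.
  move: ik; rewrite mem_iota add0n /= leq_eqVlt => /orP[/eqP->|] //.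
  exact: mem_krylov.
have kerK : (krylov k B v :&: lker f = 0)%VS.
  apply/eqP; rewrite -subv0; apply/subvP => u; rewrite memv_cap memv_ker fE.
  by case/andP=> uK /eqP Bu0; rewrite (injB u) ?mem0v.
have fKE : (f @: krylov k B v)%VS = krylov k B v.
  by apply/eqP; rewrite eqEdim fK (limg_dim_eq kerK) leqnn.
have := krylov_start Kk; rewrite -{1}fKE => /memv_imgP[y yK vE].
by exists y; rewrite // vE fE.
Qed.

End Krylov.

(** Each positive power of [A G] has [A] as its leftmost factor, and the
    zeroth term of the sequence is [A x] itself. *)
Lemma krylov_range (R : realType) n (A G : 'M[R]_n) (x u : 'cV[R]_n) k :
  u \in krylov k (A *m G) (A *m x) -> exists y, u = A *m y.
Proof.
pose f : 'End('cV[R]_n) := linfun (mulmx A).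
suff /subvP sub : (krylov k (A *m G) (A *m x) <= limg f)%VS.
  by move=> /sub /memv_imgP[y _ uE]; exists y; rewrite uE lfunE.
apply/span_subvP => _ /mapP[i _ ->].
have imA y : A *m y \in limg f.
  by rewrite -[A *m y]/(mulmx A y) -(lfunE (mulmx A)) memv_img ?memvf.
case: i => [|i]; first by rewrite expr0 mul1mx.
by rewrite exprS -[_ * _]/(A *m G *m (A *m G) ^+ i) -!mulmxA.
Qed.

Theorem theorem3p9 (R : realType) (n : nat) (A G : 'M[R]_n) (eps : R)
    (hG : is_AGI eps A G) (b : 'cV[R]_n)
    (hb : b \in range (fun x : 'cV[R]_n => A *m x)) (x0 : 'cV[R]_n) :
  gmres_converges A G b x0.
Proof.
have [xb _ bE] := set_mem hb.
have r0E : b - A *m x0 = A *m (xb - x0) by rewrite mulmxBr bE.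
have [k [freeK Kk]] := krylov_saturation (A *m G) (b - A *m x0).
have [y yK By] : exists2 y, y \in krylov k (A *m G) (b - A *m x0)
                          & A *m G *m y = b - A *m x0.
  apply: krylov_solvable Kk _ => u; rewrite r0E => /krylov_range[z ->].
  exact: AGI_injective_on_range hG.
exists k; split.
- by move=> j /freeK jfree; rewrite /gmres_breakdown jfree.
- exists (x0 + G *m y), y; split=> // z _.
  by rewrite By subrr norm20 norm2_ge0.
- move=> x [y' [_ ymin ->]] z.
  have := ymin y yK; rewrite By subrr norm20.
  by rewrite mulmxDr mulmxA opprD addrA => /le_trans; apply; apply: norm2_ge0.
Qed.
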